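(* Let $n\geq\ell\geq2$ be integers, fix a labeling of the rooted binary tree $T_n$ with root $x_0$, and let $G\subseteq M_{\ell,n}$ be a subgroup. Suppose that the group obtained by restricting the elements of $G$ to the subtree $T_{n-1}$ is all of $M_{\ell,n-1}$, and suppose there exists $\sigma_n\in G$ that acts trivially on $T_{n-1}$ and is an $(\ell,n)$-odd cousins map above $x_0$. Then $G=M_{\ell,n}$.
   Context: $T_\infty$ is the infinite rooted binary tree with root $x_0$, and $T_n$ its subtree of levels $0,\dots,n$. A labeling assigns to each node at level $m$ a word in $\{0,1\}^m$, bijectively per level, with children of $w$ labeled $w0,w1$. For a tree automorphism $\sigma$, node $y$, $m\geq1$: $\sigma$ sends the node $ys_1\dots s_m$ to $\sigma(y)t_1\dots t_m$, and $\operatorname{sgn}_m(\sigma,y)\in\{\pm1\}$ is the sign of the permutation $(s_1,\dots,s_m)\mapsto(t_1,\dots,t_m)$ of $\{0,1\}^m$. $M_\ell$ is the set of $\sigma\in\operatorname{Aut}(T_\infty)$ with $\operatorname{sgn}_\ell(\sigma,y)=+1$ for every node $y$, and $M_{\ell,n}$ is the group of restrictions of elements of $M_\ell$ to $T_n$. For $\sigma\in M_{\ell,n}$ and a node $w$ with children $y_0,y_1$ (where $\operatorname{sgn}_{\ell-1}(\sigma,y_0)=\operatorname{sgn}_{\ell-1}(\sigma,y_1)$ automatically), $\sigma$ acts $\ell$-negatively above $w$ if $\operatorname{sgn}_{\ell-1}(\sigma,y_0)=\operatorname{sgn}_{\ell-1}(\sigma,y_1)=-1$. For $n\geq\ell$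 and a node $x$, $\sigma$ is an $(\ell,n)$-odd cousins map above $x$ if the number of nodes $w$ lying $n-\ell$ levels above $x$ such that $\sigma$ acts $\ell$-negatively above $w$ is odd; otherwise it is an $(\ell,n)$-even cousins map above $x$. *)

(* Defs.v *)
From mathcomp Require Export all_boot all_order all_fingroup all_algebra.
From mathcomp Require Export boolp.

Set Implicit Arguments.
Unset Strict Implicit.
Unset Printing Implicit Defensive.

(* The infinite rooted binary tree is modelled on seq bool: the root is [::],
   the level of a node is its size, and the children of v are rcons v false
   and rcons v true.  A labeling is a separate datum (see [labeling]), so these
   underlying sequences are only names of nodes, not their labels. *)
Definition child (v w : seq bool) : bool := [exists b : bool, w == rcons v b].

Notation treeinf := (seq bool).
Notation tree n := (n.-bseq bool).

Definition tree_root (n : nat) : tree n := [bseq].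

Definition tree_aut (f : treeinf -> treeinf) : Prop :=
  [/\ bijective f, f [::] = [::] & forall v w, child (f v) (f w) = child v w].

Definition labeling (lab : treeinf -> seq bool) : Prop :=
  [/\ forall v, size (lab v) = size v,
      forall m (w : m.-tuple bool), exists! v : treeinf, size v = m /\ lab v = w
    & forall v w, child v w -> child (lab v) (lab w)].

(* The node type V below is instantiated both with treeinf and with tree n,
   the latter carrying the restricted labeling. *)

(* p is the permutation (s_1, .., s_m) |-> (t_1, .., t_m) such that f sends the
   node labeled y s_1 .. s_m to the one labeled f(y) t_1 .. t_m. *)
Definition induced_perm (V : Type) (lab : V -> seq bool) (m : nat)
    (f : V -> V) (y : V) (p : {perm m.-tuple bool}) : Prop :=
  forall s : m.-tuple bool, exists z : V,
    lab z = lab y ++ s /\ lab (f z) = lab (f y) ++ p s.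

(* For an automorphism and an injective labeling, the induced permutation is
   unique, and it exists as soon as the tree has m levels above y; otherwise
   the sign is undefined, which is encoded by the value 0. *)
Definition sgn (V : Type) (lab : V -> seq bool) (m : nat)
    (f : V -> V) (y : V) : int :=
  if [pick p : {perm m.-tuple bool} | `[< induced_perm lab f y p >]] is Some p
  then ((-1) ^+ (odd_perm p))%R else 0%R.

Definition Minf (lab : treeinf -> seq bool) (l : nat) (f : treeinf -> treeinf)
  : Prop :=
  tree_aut f /\ forall y, sgn lab l f y = 1%R.

(* The map f of a tree with nodes V (named by nd) restricts to t on levels
   0, .., k. *)
Definition restricts_to (V : Type) (nd : V -> seq bool) (f : V -> V)
    (k : nat) (t : {perm tree k}) : Prop :=
  forall (v : V) (u : tree k), nd v = u -> nd (f v) = t u.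

Definition M (lab : treeinf -> seq bool) (l n : nat) : {set {perm tree n}} :=
  [set s | `[< exists2 f, Minf lab l f & restricts_to id f s >]].

Definition restr (n k : nat) (G : {set {perm tree n}}) : {set {perm tree k}} :=
  [set t | [exists s in G, `[< restricts_to (fun v : tree n => v : seq bool) s t >]]].

Definition acts_negatively (lab : treeinf -> seq bool) (l N : nat)
    (s : {perm tree N}) (w : tree N) : Prop :=
  exists y0 y1 : tree N,
    [/\ child w y0, child w y1, y0 != y1,
        sgn (fun v : tree N => lab v) l.-1 s y0 = (-1)%R
      & sgn (fun v : tree N => lab v) l.-1 s y1 = (-1)%R].

(* The ambient tree has height N, which need not be n, so that the notion makes
   sense at every node x of level at most N - n. *)
Definition odd_cousins (lab : treeinf -> seq bool) (l n N : nat)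
    (s : {perm tree N}) (x : tree N) : Prop :=
  odd #|[set w : tree N | [&& prefix x w, size w == size x + (n - l)
                            & `[< acts_negatively lab l s w >]]]|.

Definition acts_trivially (n k : nat) (s : {perm tree n}) : Prop :=
  forall v : tree n, size v <= k -> s v = v.

(* Main.v *)
(** Read through the labeling, an automorphism is a portrait: the bits telling
at which nodes it flips the two children.  The sign at level [m] above [y] is the
parity of the bits at depth [m - 1] above [y], since a flip lower down is an even
permutation.  So [M_l] consists of the portraits whose bits at depth [l - 1] above
every node sum to zero.

[M_{l,n}] is a 2-group.  If [G] were proper in it, some index-2 subgroup would
contain [G], giving a nontrivial character [chi] of [M_{l,n}] that vanishes on [G].
On the kernel of the restriction to [T_{n-1}], [chi] is invariant under conjugation,
and [M_{l,n}] acts transitively on the pairs of nodes of level [n - 1] that part at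
level [n - l].  Hence [chi] takes one value [c] on all elements flipping such a pair,
so it vanishes on those flipping a pair that parts strictly above level
[n - l], and [chi] is [c] times the odd-cousins parity.  As [chi sigma_n] vanishes,
so does [c]; then [chi] vanishes on the kernel and on [G], which together generate
[M_{l,n}]. *)

Require Import Defs.
From mathcomp Require Import zify all_solvable.

Set Implicit Arguments.
Unset Strict Implicit.
Unset Printing Implicit Defensive.

(** * Portraits, their action on words and their product *)

Definition portrait := seq bool -> bool.

Definition shift (a : portrait) (p : seq bool) : portrait := fun v => a (p ++ v).

(** Each letter is flipped according to the bit of [a] at the prefix before it, taken in the source
    word and not in its image. *)
Fixpoint act (a : portrait) (v : seq bool) : seq bool :=
  if v is b :: v' then (b (+) a [::]) :: act (shift a [:: b]) v' else [::].

(** The factor [a] acts first, as in products of permutations, so [b] is read at the image under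
    [a]. *)
Definition pmul (a b : portrait) : portrait := fun v => a v (+) b (act a v).

Definition balanced (l : nat) (a : portrait) : Prop :=
  forall p, \big[addb/false]_(t : l.-1.-tuple bool) a (p ++ t) = false.

Lemma size_act a v : size (act a v) = size v.
Proof. by elim: v a => //= b v IHv a; rewrite IHv. Qed.

Lemma act_cat a p v : act a (p ++ v) = act a p ++ act (shift a p) v.
Proof. by elim: p a => //= b p IHp a; rewrite IHp. Qed.

Lemma act_rcons a v b : act a (rcons v b) = rcons (act a v) (b (+) a v).
Proof. by rewrite -!cats1 act_cat /= /shift cats0. Qed.

Lemma act_inj a : injective (act a).
Proof.
move=> v; elim: v a => [|b v IHv] a [|c w] //= [] /addIb <- /IHv -> //.
Qed.

Lemma act_pmul a b v : act b (act a v) = act (pmul a b) v.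
Proof. by elim/last_ind: v => // v x IHv; rewrite !act_rcons IHv -addbA. Qed.

Lemma eq_act k a b v : (forall w, size w < k -> a w = b w) ->
  size v <= k -> act a v = act b v.
Proof.
move=> eab; elim/last_ind: v => // v x IHv; rewrite size_rcons => lt_vk.
by rewrite !act_rcons IHv ?eab // ltnW.
Qed.

Lemma act_eq k a b : (forall v, size v <= k -> act a v = act b v) ->
  forall w, size w < k -> a w = b w.
Proof.
move=> eab w lt_wk; have := eab (rcons w false); rewrite size_rcons !act_rcons.
by move=> /(_ lt_wk) /rcons_inj [].
Qed.

Lemma act_false v : act (fun=> false) v = v.
Proof. by elim/last_ind: v => // v b IHv; rewrite act_rcons IHv addbF. Qed.

Lemma act_small k a v : (forall w, size w < k -> a w = false) ->
  size v <= k -> act a v = v.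
Proof. by move=> a0 le_vk; rewrite (@eq_act k a (fun=> false) v) ?act_false. Qed.

Lemma act_path a u u' : size u = size u' ->
  (forall i, i < size u -> a (take i u) = nth false u i (+) nth false u' i) ->
  act a u = u'.
Proof.
elim/last_ind: u u' => [|u b IHu] u'; first by case: u'.
case/lastP: u' => [|u' b']; rewrite !size_rcons // => -[eq_sz] au.
rewrite act_rcons (IHu u') // => [|i lt_iu].
  have := au (size u) (ltnSn _); rewrite -cats1 take_size_cat // cats1.
  by rewrite !nth_rcons ltnn eqxx eq_sz ltnn eqxx => ->; rewrite addKb.
have := au i (ltnW lt_iu); rewrite -cats1 take_cat lt_iu => ->.
by rewrite cats1 !nth_rcons lt_iu -eq_sz lt_iu.
Qed.

(** The bit at [v] is the last letter of the image of the false child of [v]; injectivity forces the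
    other letter on the true child. *)
Lemma act_portrait (F : seq bool -> seq bool) :
    F [::] = [::] -> injective F -> (forall v w, child v w -> child (F v) (F w)) ->
  exists a, forall v, F v = act a v.
Proof.
move=> F0 Finj Fch; pose a v := last false (F (rcons v false)).
have chF v b : exists c, F (rcons v b) = rcons (F v) c.
  have: child v (rcons v b) by apply/existsP; exists b.
  by move/Fch/existsP => [c /eqP]; exists c.
exists a; elim/last_ind => // v b IHv; rewrite act_rcons -IHv /a.
have [c Ec] := chF v false; rewrite Ec last_rcons.
case: b; last by rewrite Ec addFb.
have [c' Ec'] := chF v true; rewrite Ec' addTb; congr rcons.
case: (eqVneq c' c) => [e|]; last by case: c' c {Ec Ec'} => [] [].
by have: rcons v true = rcons v false by [apply: Finj; rewrite Ec Ec' e];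
  move/rcons_inj => [].
Qed.

Definition act_tuple a m (t : m.-tuple bool) : m.-tuple bool :=
  tcast (etrans (size_act a t) (size_tuple t)) (in_tuple (act a t)).

Lemma val_act_tuple a m (t : m.-tuple bool) : act_tuple a t = act a t :> seq bool.
Proof. by rewrite /act_tuple val_tcast. Qed.

Lemma act_tuple_inj a m : injective (@act_tuple a m).
Proof.
move=> t t' e; apply: val_inj; apply: (@act_inj a).
by rewrite /= -!val_act_tuple e.
Qed.

(** As [t] varies, [act a (p ++ t)] runs once over the words of that length extending [act a p], so
    the contribution of [b] is its sum above [act a p]. *)
Lemma balanced_pmul l a b : balanced l a -> balanced l b -> balanced l (pmul a b).
Proof.
move=> ba bb p; rewrite big_split /= ba addFb -[RHS](bb (act a p)).
rewrite [RHS](reindex_inj (@act_tuple_inj (shift a p) _)).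
by apply: eq_bigr => t _; rewrite act_cat val_act_tuple.
Qed.

(** * Signs of the permutations induced by portraits *)

(** Through [i], [P] permutes two-point fibres by [q] and flips them by [e]. A transposition of the
    base lifts to two transpositions, an even permutation, so only the flips count. *)
Lemma odd_perm_skew (T U : finType) (i : T * bool -> U) (q : {perm T})
    (e : T -> bool) (P : {perm U}) :
    bijective i -> (forall x b, P (i (x, b)) = i (q x, b (+) e x)) ->
  odd_perm P = \big[addb/false]_x e x.
Proof.
move=> i_bij; have i_inj := bij_inj i_bij.
have [r -> {q}] := prod_tpermP q => nz_r.
elim: r nz_r e P => [_|[x y] r IHr /= /andP[nz_xy nz_r]] e P.
  rewrite big_nil.
  (* For trivial [q], [P] is a product of disjoint transpositions, one for each [x] with [e x]; they
     are removed one at a time. *)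
  have [m] := ubnP #|[pred x | e x]|; elim: m => // m IHm in e P * => le_em Pi.
  have [x0 ex0|e0] := pickP e; last first.
    rewrite big1 // (_ : P = 1%g) ?odd_perm1 //; apply/permP => u.
    by have [j _ jK] := i_bij; rewrite -(jK u); case: (j u) => x b;
      rewrite Pi !perm1 e0 addbF.
  pose P' := (tperm (i (x0, false)) (i (x0, true)) * P)%g.
  have := IHm (fun x => if x == x0 then false else e x) P'.
  rewrite odd_mul_tperm (inj_eq i_inj) xpair_eqE andbF /= => IH.
  rewrite -[odd_perm P]negbK IH => [||x b].
  - rewrite [in RHS](bigD1 x0) //= (bigD1 x0) //= eqxx ex0 addFb addTb; congr negb.
    by apply: eq_bigr => x /negPf->.
  - apply: (@leq_trans #|[pred x | e x]|) => //; rewrite [X in _ < X](cardD1 x0) inE ex0.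
    rewrite ltnS; apply: subset_leq_card; apply/subsetP => x; rewrite !inE.
    by case: eqP.
  - rewrite permM; case: eqVneq => [->|ne].
      case: b; rewrite ?tpermR ?tpermL Pi ex0 !perm1 //.
    by rewrite tpermD ?Pi // (inj_eq i_inj) xpair_eqE eq_sym (negPf ne).
rewrite big_cons => Pi /=.
(* The lift of the first transposition, one copy for each bit, is cancelled from [P]; the flips are
   then read along [tperm x y]. *)
pose P' := (tperm (i (x, false)) (i (y, false))
            * (tperm (i (x, true)) (i (y, true)) * P))%g.
have := IHr nz_r (fun z => e (tperm x y z)) P'.
rewrite !odd_mul_tperm !(inj_eq i_inj) !xpair_eqE !eqxx !andbT (negPf nz_xy) /= negbK.
move=> ->; first by rewrite [RHS](reindex_inj (@perm_inj _ (tperm x y))).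
move=> z b; rewrite !permM.
have -> : tperm (i (x, true)) (i (y, true))
       (tperm (i (x, false)) (i (y, false)) (i (z, b))) = i (tperm x y z, b).
  have ne c : tperm (i (x, ~~ c)) (i (y, ~~ c)) (i (z, c)) = i (z, c).
    by rewrite tpermD // (inj_eq i_inj) xpair_eqE; case: (c); rewrite andbF.
  have eqt c : tperm (i (x, c)) (i (y, c)) (i (z, c)) = i (tperm x y z, c).
    case: (tpermP x y z) => [->|->|/eqP nx /eqP ny]; rewrite ?tpermL ?tpermR //.
    by rewrite tpermD // (inj_eq i_inj) xpair_eqE eqxx andbT eq_sym.
  case: b; first by rewrite (ne true) (eqt true).
  rewrite (eqt false).
  rewrite tpermD // (inj_eq i_inj) xpair_eqE andbF //.
by rewrite Pi permM tpermK.
Qed.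

(** Splitting off the last letter makes [p] a skew product over words of length [m], with flip [a t]
    over [t]. *)
Lemma odd_act_perm a m (p : {perm m.+1.-tuple bool}) :
  (forall t, p t = act a t :> seq bool) ->
  odd_perm p = \big[addb/false]_(t : m.-tuple bool) a t.
Proof.
move=> pE.
pose i (x : m.-tuple bool * bool) : m.+1.-tuple bool := [tuple of rcons x.1 x.2].
apply: (@odd_perm_skew _ _ i (perm (@act_tuple_inj a m))) => [|x b]; last first.
  by apply: val_inj; rewrite /= pE /= act_rcons permE val_act_tuple.
apply: inj_card_bij => [[x b] [y c] /(congr1 val) /= /rcons_inj [e ->]|].
  by congr pair; apply: val_inj.
by rewrite card_prod !card_tuple card_bool expnSr.
Qed.

(** The second hypothesis says that the tree reaches [m.+1] levels above [y], which rules out the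
    default value 0 of [sgn]. *)
Lemma sgn_act (V : Type) (lab : V -> seq bool) (m : nat) (f : V -> V) (y : V) a :
    (forall v, lab (f v) = act a (lab v)) ->
    (forall s : m.+1.-tuple bool, exists z, lab z = lab y ++ s) ->
  sgn lab m.+1 f y =
    ((-1) ^+ (\big[addb/false]_(t : m.-tuple bool) a (lab y ++ t)))%R.
Proof.
move=> fa ex; rewrite /sgn; case: pickP => [p /asboolP ip|].
  congr (_ ^+ _)%R; congr nat_of_bool; rewrite (@odd_act_perm (shift a (lab y))) // => s.
  have [z [ez]] := ip s; rewrite !fa ez act_cat => /eqP.
  by rewrite eqseq_cat // eqxx /= => /eqP.
move/(_ (perm (@act_tuple_inj (shift a (lab y)) m.+1)))/asboolPn; case=> s.
by have [z ez] := ex s; exists z; rewrite !fa ez act_cat permE val_act_tuple.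
Qed.

(** * Balanced portraits, pairs of nodes and forks *)

Lemma big_addb_tupleS k (g : seq bool -> bool) :
  \big[addb/false]_(t : k.+1.-tuple bool) g t =
    \big[addb/false]_(t : k.-tuple bool) g (true :: t)
      (+) \big[addb/false]_(t : k.-tuple bool) g (false :: t).
Proof.
pose h (x : bool * k.-tuple bool) : k.+1.-tuple bool := [tuple of x.1 :: x.2].
rewrite (reindex h) /=; last first.
  exists (fun t => (thead t, [tuple of behead t])) => [[b t] _|t _].
    by congr pair; apply: val_inj.
  by rewrite [RHS]tuple_eta; apply: val_inj.
by rewrite -(pair_bigA _ (fun b t => g (b :: tval t))) big_bool.
Qed.

Lemma addb_sum_eq_cat k (p u : seq bool) :
  \big[addb/false]_(t : k.-tuple bool) (p ++ t == u) =
    (size p + k == size u) && (p == take (size u - k) u).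
Proof.
case: eqP => [sz|nsz] /=; last first.
  rewrite big1 // => t _; apply/eqP => e; case: nsz.
  by rewrite -e size_cat size_tuple.
rewrite -sz addnK.
have sz_drop : size (drop (size p) u) == k by rewrite size_drop -sz addKn.
rewrite (bigD1 (Tuple sz_drop)) //= big1 => [|t /negPf net].
  rewrite addbF -{2}[u](cat_take_drop (size p)) eqseq_cat ?eqxx ?andbT //.
  by rewrite size_takel // -sz leq_addr.
apply/negbTE; apply: contraFN net => /eqP e.
by apply/eqP/val_inj; rewrite /= -e drop_size_cat.
Qed.

(** With exclusive or in place of disjunction, the portrait vanishes when [u = w], and pairs sharing
    a node add up. *)
Definition epair (u w : seq bool) : portrait := fun v => (v == u) (+) (v == w).

(** The nodes [u] and [w] have the same ancestor [l.-1] levels up, so each sum condition sees both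
    of them or neither. *)
Lemma balanced_epair l u w : size u = size w ->
  take (size u - l.-1) u = take (size u - l.-1) w -> balanced l (epair u w).
Proof.
by move=> sz tk p; rewrite big_split /= !addb_sum_eq_cat tk sz addbb.
Qed.

Lemma epair_small u w k v : size u = k -> size w = k -> size v < k ->
  epair u w v = false.
Proof.
move=> su sw sv; have ne x : size x = k -> (v == x) = false.
  by move=> sx; apply/eqP => e; rewrite e sx ltnn in sv.
by rewrite /epair !ne.
Qed.

Lemma balanced0 l : balanced l (fun=> false).
Proof. by move=> p; rewrite big1. Qed.

Lemma balanced_sum l (I : Type) (r : seq I) (F : I -> portrait) :
  (forall i, balanced l (F i)) ->
  balanced l (fun v => \big[addb/false]_(i <- r) F i v).
Proof. by move=> bF p; rewrite exchange_big big1 // => i _; apply: bF. Qed.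

(* With [n = m + k + 2] and [l = k + 2]: [u], [w] have level [n - 1] and part
   at level [n - l]. *)
Definition fork (m k : nat) (u w : seq bool) : Prop :=
  [/\ size u = (m + k).+1, size w = (m + k).+1, take m u = take m w
    & nth false u m != nth false w m].

Lemma balanced_fork m k u w : fork m k u w -> balanced k.+2 (epair u w).
Proof.
case=> su sw tk _; apply: balanced_epair; first by rewrite sw.
by rewrite su /= subSS addnK.
Qed.

(* Each sum condition at [p] is met by changing the portrait at one node [p ++ c p],
   at depth [l - 1] above [p]. *)
Lemma balance_correction l (a : portrait) (c : seq bool -> seq bool) :
    (forall p, size (c p) = l.-1) ->
  exists2 b, balanced l b & forall v, a v != b v ->
    exists p, v = p ++ c p.
Proof.
move=> sc; pose S p := \big[addb/false]_(t : l.-1.-tuple bool) a (p ++ t).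
pose p_ (v : seq bool) := take (size v - l.-1) v.
(* If [v] is shorter than [l.-1], truncated subtraction gives [p_ v = [::]], and the equality test
   fails because the lengths differ. *)
exists (fun v => a v (+) (v == p_ v ++ c (p_ v)) && S (p_ v)) => [p|v]; last first.
  case: (v =P _) => [e _|_]; first by exists (p_ v).
  by rewrite addbF eqxx.
have scp : size (c p) == l.-1 by rewrite sc.
have pE (t : l.-1.-tuple bool) : p_ (p ++ t) = p.
  by rewrite /p_ size_cat size_tuple addnK take_size_cat.
rewrite big_split /= -/(S p) (bigD1 (Tuple scp)) //= (pE (Tuple scp)) eqxx /=.
rewrite big1 ?addbF ?addbb // => t; rewrite pE.
by rewrite eqseq_cat // eqxx /= -val_eqE /= => /negPf->.
Qed.

Lemma nth_eq_take m (u w : seq bool) i : take m u = take m w -> i < m ->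
  nth false u i = nth false w i.
Proof. by move=> tk im; rewrite -(nth_take _ im) tk nth_take. Qed.

(** The bits needed along the two paths are prescribed first; balance is then restored at nodes off
    both paths. *)
Lemma fork_trans m k u w u' w' : fork m k u w -> fork m k u' w' ->
  exists2 a, balanced k.+2 a & act a u = u' /\ act a w = w'.
Proof.
move=> [su sw tk nm] [su' sw' tk' nm'].
pose a0 (v : seq bool) := let i := size v in
  if v == take i u then nth false u i (+) nth false u' i
  else if v == take i w then nth false w i (+) nth false w' i else false.
(* The first letter of [c p] turns away from [u], and also from [w] when [size p < m], where the two
   words agree. *)
pose c (p : seq bool) := ~~ nth false u (size p) :: nseq k false.
have [p|a ba a_eq] := @balance_correction k.+2 a0 c.
  by rewrite /c /= size_nseq.
(* A correction at a level below [(m + k).+1] belongs to some [p] with [size p < m], hence lies off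
   the paths. *)
have notc x i : size x = (m + k).+1 -> take m x = take m u -> i < (m + k).+1 ->
    a (take i x) = a0 (take i x).
  move=> sx tkx lti; apply/eqP; rewrite eq_sym; apply: contraT => /a_eq [p].
  have szi : size (take i x) = i by rewrite size_takel // sx ltnW.
  move=> e; have szp : i = size p + k.+1.
    by rewrite -{1}szi e size_cat /c /= size_nseq.
  have ltp : size p < m by lia.
  have := congr1 (fun s => nth false s (size p)) e.
  rewrite nth_take; last by lia.
  rewrite nth_cat ltnn subnn /= (nth_eq_take tkx ltp).
  by case: (nth _ _ _).
exists a => //; split; apply: act_path; rewrite ?su ?su' ?sw ?sw' // => i lti.
  by rewrite notc // /a0 size_takel ?su 1?ltnW // eqxx.
rewrite notc // /a0 size_takel ?sw 1?ltnW // eqxx.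
(* At a node common to both paths the two prescriptions must agree. At level [m] they do because
   each fork has opposite letters there. *)
case: eqP => // e; have [ltim|ltmi|->] := ltngtP i m.
- by rewrite (nth_eq_take tk ltim) (nth_eq_take tk' ltim).
- by move: nm; rewrite -(nth_take _ ltmi) -e nth_take // eqxx.
- by move: nm nm'; do 4!case: (nth _ _ _).
Qed.

(** * Characters on portraits concentrated in the last level *)

(* [chi] plays the role of a homomorphism to Z/2 on the group of level-[n]
   truncations of balanced portraits. *)
Definition pchar (n l : nat) (chi : portrait -> bool) : Prop :=
  (forall a b, balanced l a -> balanced l b -> chi (pmul a b) = chi a (+) chi b)
  /\ (forall a b, (forall v, size v < n -> a v = b v) -> chi a = chi b).

Lemma pchar0 n l chi : pchar n l chi -> chi (fun=> false) = false.
Proof.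
case=> chiM chiE; have := chiM _ _ (@balanced0 l) (@balanced0 l).
rewrite (chiE _ (fun=> false)) //.
by case: (chi _).
Qed.

(** When [a] vanishes below level [n], it fixes all words of length at most [n], so the product is
    the pointwise sum on the levels that [chi] sees. *)
Lemma pchar_add n l chi a b : pchar n.+1 l chi -> balanced l a -> balanced l b ->
    (forall v, size v < n -> a v = false) ->
  chi (fun v => a v (+) b v) = chi a (+) chi b.
Proof.
move=> [chiM chiE] ba bb a0; rewrite -chiM //; apply: chiE => v.
by rewrite ltnS => szv; rewrite /pmul (act_small a0).
Qed.

Lemma pchar_sum n l chi (I : Type) (r : seq I) (F : I -> portrait) :
    pchar n.+1 l chi -> (forall i, balanced l (F i)) ->
    (forall i v, size v < n -> F i v = false) ->
  chi (fun v => \big[addb/false]_(i <- r) F i v) = \big[addb/false]_(i <- r) chi (F i).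
Proof.
move=> hchi bF F0; have [_ chiE] := hchi; elim: r => [|i r IHr].
  rewrite big_nil -[RHS](pchar0 hchi); apply: chiE => v _; exact: big_nil.
rewrite big_cons -IHr -(pchar_add hchi (bF i) (balanced_sum r bF) (F0 i)).
by apply: chiE => v _; rewrite big_cons.
Qed.

(** Up to level [n], [epair u w] followed by [a] equals [a] followed by [epair u' w']; the value
    [chi a] cancels. *)
Lemma pchar_conj n l chi a u w u' w' : pchar n.+1 l chi -> balanced l a ->
    size u = n -> size w = n -> balanced l (epair u w) -> balanced l (epair u' w') ->
    act a u = u' -> act a w = w' ->
  chi (epair u w) = chi (epair u' w').
Proof.
move=> [chiM chiE] ba su sw buw buw' au aw; apply: (@addbI (chi a)).
rewrite -[RHS]chiM // addbC -chiM //; apply: chiE => v; rewrite ltnS => szv.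
rewrite /pmul (act_small (k := n)) // => [|x]; last exact: epair_small.
by rewrite addbC /epair -au -aw !(inj_eq (@act_inj a)).
Qed.

Lemma pchar_fork m k chi u w u' w' : pchar (m + k).+2 k.+2 chi ->
  fork m k u w -> fork m k u' w' -> chi (epair u w) = chi (epair u' w').
Proof.
move=> hchi f f'; have [a ba [au aw]] := fork_trans f f'.
have [su sw _ _] := f.
by apply: (pchar_conj hchi ba) => //; apply: balanced_fork; [exact: f|exact: f'].
Qed.

Lemma fork_cat m k y t t' (b : bool) : size y = m -> size t = k -> size t' = k ->
  fork m k (y ++ b :: t) (y ++ ~~ b :: t').
Proof.
move=> sy st st'; split; rewrite ?size_cat /= ?sy ?st ?st' ?addnS //.
  by rewrite -sy !take_size_cat.
by rewrite !nth_cat sy ltnn subnn /=; case: b.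
Qed.

(** Two nodes in the same half are joined through a node [w] of the other half: their pair is a sum
    of two forks, whose equal values cancel. *)
Lemma pchar_half m k chi y t t' (b : bool) : pchar (m + k).+2 k.+2 chi ->
    size y = m -> size t = k -> size t' = k ->
  chi (epair (y ++ b :: t) (y ++ b :: t')) = false.
Proof.
move=> hchi sy st st'; pose w := y ++ ~~ b :: t.
have f1 : fork m k (y ++ b :: t) w by apply: fork_cat.
have f2 : fork m k w (y ++ b :: t').
  by rewrite -[in y ++ b :: t'](negbK b); apply: fork_cat.
have [_ chiE] := hchi.
rewrite -(chiE (fun v => epair (y ++ b :: t) w v (+) epair w (y ++ b :: t') v)).
  rewrite (pchar_add hchi (balanced_fork f1) (balanced_fork f2)).
    by rewrite (pchar_fork hchi f1 f2) addbb.
  by move=> v; case: f1 => su sw _ _; apply: epair_small.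
by move=> v _; rewrite /epair addbA addbK.
Qed.

(** A base fork, on which [chi] takes the common value of all forks. *)
Definition fork_ref m k : portrait :=
  epair (nseq m false ++ true :: nseq k false) (nseq m false ++ false :: nseq k false).

Lemma pchar_top m k chi a : pchar (m + k).+2 k.+2 chi -> balanced k.+2 a ->
    (forall v, size v < (m + k).+1 -> a v = false) ->
  chi a = chi (fork_ref m k) &&
    \big[addb/false]_(y : m.-tuple bool) \big[addb/false]_(t : k.-tuple bool)
      a (y ++ true :: t).
Proof.
move=> hchi ba a0; have [_ chiE] := hchi.
have sz0 : size (nseq k.+1 false) == k.+1 by rewrite size_nseq.
pose z := Tuple sz0.
(* Above each [y] of level [m], every bit of [a] is paired with the base node [y ++ z]. *)
pose F (x : m.-tuple bool * k.+1.-tuple bool) : portrait :=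
  fun v => a (x.1 ++ x.2) && epair (x.1 ++ x.2) (x.1 ++ z) v.
have szx (y : m.-tuple bool) (t : k.+1.-tuple bool) : size (y ++ t) = (m + k).+1.
  by rewrite size_cat !size_tuple addnS.
have aE v : size v < (m + k).+2 -> a v = \big[addb/false]_x F x v.
  rewrite ltnS leq_eqVlt => /orP[/eqP szv|ltv]; last first.
    by rewrite a0 // big1 // => x _; rewrite /F (@epair_small _ _ (m + k).+1) ?andbF.
  rewrite -(pair_bigA _ (fun y t => F (y, t) v)) /=.
  have szT : size (take m v) == m by rewrite size_takel // szv; lia.
  have szD : size (drop m v) == k.+1 by rewrite size_drop szv; apply/eqP; lia.
  transitivity (\big[addb/false]_(y : m.-tuple bool)
      \big[addb/false]_(t : k.+1.-tuple bool) (a v && (v == y ++ t))).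
    rewrite (bigD1 (Tuple szT)) //= (bigD1 (Tuple szD)) //= cat_take_drop eqxx andbT.
    rewrite big1 => [|t /negPf nt].
      rewrite big1 ?addbF // => y /negPf ny; rewrite big1 // => t _.
      apply/negbTE; rewrite negb_and; apply/orP; right.
      apply: contraFN ny => /eqP e; apply/eqP/val_inj.
      by rewrite /= e take_size_cat ?size_tuple.
    apply/negbTE; rewrite negb_and; apply/orP; right.
    apply: contraFN nt => /eqP e; apply/eqP/val_inj.
    by rewrite /= e drop_size_cat // size_takel // szv; lia.
  apply: eq_bigr => y _; rewrite /F /=.
  (* The inserted second sum is zero by balance above [y]; it supplies the base node of each
     pair. *)
  transitivity (\big[addb/false]_(t : k.+1.-tuple bool) (a (y ++ t) && (v == y ++ t))
     (+) \big[addb/false]_(t : k.+1.-tuple bool) ((v == y ++ z) && a (y ++ t))).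
    rewrite [X in _ (+) X](_ : _ = false) ?addbF.
      by apply: eq_bigr => t _; case: eqP => [->|]; rewrite ?andbF.
    by case: eqP => _; [exact: ba|rewrite big1].
  rewrite -big_split /=; apply: eq_bigr => t _; rewrite /epair.
  by case: (a _); rewrite ?andbT ?andbF.
rewrite (chiE _ _ aE) (pchar_sum _ hchi); first last.
- by move=> x v ltv; rewrite /F (@epair_small _ _ (m + k).+1) ?andbF.
- move=> [y t]; rewrite /F /=; case: (a _) => /=; last exact: balanced0.
  apply: balanced_epair; first by rewrite !szx.
  by rewrite szx /= subSS addnK !take_size_cat ?size_tuple.
have chiF x : chi (F x) = a (x.1 ++ x.2) && chi (epair (x.1 ++ x.2) (x.1 ++ z)).
  by rewrite /F; case: (a _) => //=; exact: pchar0 hchi.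
rewrite (eq_bigr _ (fun x _ => chiF x)).
rewrite -(pair_bigA _ (fun (y : m.-tuple bool) (t : k.+1.-tuple bool) =>
   a (y ++ t) && chi (epair (y ++ t) (y ++ z)))) /=.
rewrite (big_distrr (chi (fork_ref m k))) /=; apply: eq_bigr => y _.
(* As [z] starts with false, words starting with true give forks, and the others give pairs within
   one half, where [chi] vanishes. *)
rewrite (big_addb_tupleS _ (fun t => a (y ++ t) && chi (epair (y ++ t) (y ++ z)))).
rewrite [X in _ (+) X]big1 ?addbF => [|t _].
  rewrite big_distrr /=; apply: eq_bigr => t _; rewrite andbC; congr andb.
  by apply: (pchar_fork hchi); apply: fork_cat; rewrite ?size_tuple ?size_nseq.
by rewrite (pchar_half false hchi) ?andbF ?size_tuple ?size_nseq.
Qed.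

(** * Labeled tree automorphisms and their portraits *)

Lemma childP v w : reflect (exists b, w = rcons v b) (child v w).
Proof. by apply: (iffP existsP) => -[b /eqP]; exists b => //; apply/eqP. Qed.

Lemma child_act a v w : child (act a v) (act a w) = child v w.
Proof.
apply/childP/childP => [[b]|[b ->]]; last by eexists; apply: act_rcons.
case/lastP: w => [|w c]; first by case: (act a v).
by rewrite act_rcons => /rcons_inj[/act_inj <- _]; exists c.
Qed.

Lemma act_surj a v : exists w, act a w = v.
Proof.
elim/last_ind: v => [|v b [w <-]]; first by exists [::].
by exists (rcons w (b (+) a w)); rewrite act_rcons addbK.
Qed.

Lemma labeling_size lab v : labeling lab -> size (lab v) = size v.
Proof. by case. Qed.

Lemma labeling_inj lab : labeling lab -> injective lab.
Proof.
case=> sz uni _ v w e; have szw : size (lab w) == size v by rewrite -e sz.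
have [x [_ xu]] := uni _ (Tuple szw).
have <- : x = v by apply: xu.
by apply: xu; rewrite -(sz w) (eqP szw).
Qed.

Lemma labeling_inv lab : labeling lab ->
  exists2 ilab, cancel lab ilab & cancel ilab lab.
Proof.
move=> hlab; have [_ uni _] := hlab.
have [|ilab ilabK] := @boolp.choice _ _ (fun s v => lab v = s).
  move=> s; have [v [[_ ev] _]] := uni _ (in_tuple s).
  by exists v.
by exists ilab => // v; apply: (labeling_inj hlab); rewrite ilabK.
Qed.

Lemma child_labeling lab v w : labeling lab -> child (lab v) (lab w) = child v w.
Proof.
move=> hlab; have [_ _ ch] := hlab.
apply/idP/idP => [/childP[b]|]; last exact: ch.
case/lastP: w => [|w c].
  by move/(congr1 size); rewrite size_rcons labeling_size.
have /ch/childP[d ->] : child w (rcons w c) by apply/childP; exists c.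
by case/rcons_inj => /(labeling_inj hlab) <- _; apply/childP; exists c.
Qed.

Lemma Minf_portrait lab m f : labeling lab ->
  Minf lab m.+1 f <->
  exists2 a, balanced m.+1 a & forall v, lab (f v) = act a (lab v).
Proof.
move=> hlab; have [ilab labK ilabK] := labeling_inv hlab.
have lab0 : lab [::] = [::] by apply: size0nil; rewrite labeling_size.
have sgnE a y : (forall v, lab (f v) = act a (lab v)) ->
  sgn lab m.+1 f y = ((-1) ^+ (\big[addb/false]_(t : m.-tuple bool) a (lab y ++ t)))%R.
  by move=> fa; apply: sgn_act => // s; exists (ilab (lab y ++ s)).
split=> [[[f_bij f0 fch] fs]|[a ba fa]].
  have [|||a Ea] := @act_portrait (fun v => lab (f (ilab v))).
  - by rewrite -{1}lab0 labK f0 lab0.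
  - exact: inj_comp (labeling_inj hlab) (inj_comp (bij_inj f_bij) (can_inj ilabK)).
  - by move=> v w vw; rewrite child_labeling // fch -(child_labeling _ _ hlab) !ilabK.
  have fa v : lab (f v) = act a (lab v) by rewrite -Ea labK.
  exists a => // p; have := fs (ilab p); rewrite (sgnE a) // ilabK.
  by case: (\big[_/_]_(_ : _) _).
split; last by move=> y; rewrite (sgnE a) // ba.
have f_inj : injective f.
  by move=> v w e; apply/(labeling_inj hlab)/(@act_inj a); rewrite -!fa e.
split=> [||v w].
- have [|g gK] := @boolp.choice _ _ (fun v w => f w = v).
    move=> v; have [w ew] := act_surj a (lab v).
    by exists (ilab w); apply: (labeling_inj hlab); rewrite fa ilabK.
  by exists g => // v; apply: f_inj.
- by apply: (labeling_inj hlab); rewrite fa lab0.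
- by rewrite -(child_labeling _ _ hlab) !fa child_act child_labeling.
Qed.

(** Only the bits at levels less than [n] matter, so [s] has many portraits; [a] need not be
    truncated. *)
Definition portrays (lab : seq bool -> seq bool) n (a : portrait)
    (s : {perm tree n}) : Prop :=
  forall v : tree n, lab (s v) = act a (lab v).

Lemma portrays_ex lab n a : labeling lab -> exists s : {perm tree n}, portrays lab a s.
Proof.
move=> hlab; have [ilab labK ilabK] := labeling_inv hlab.
have szi (v : tree n) : size (ilab (act a (lab v))) <= n.
  by rewrite -(labeling_size _ hlab) ilabK size_act labeling_size // size_bseq.
pose h v : tree n := Bseq (szi v).
have h_inj : injective h.
  move=> v w /(congr1 val) /= /(can_inj ilabK) /act_inj /(labeling_inj hlab) e.
  exact: val_inj.
by exists (perm h_inj) => v; rewrite permE /= ilabK.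
Qed.

Definition perm_of_portrait lab n (hlab : labeling lab) a : {perm tree n} :=
  sval (cid (portrays_ex n a hlab)).

Lemma perm_of_portraitP lab n (hlab : labeling lab) a :
  portrays lab a (perm_of_portrait n hlab a).
Proof. by rewrite /perm_of_portrait; case: cid. Qed.

Lemma portrays_eq lab n a b (s t : {perm tree n}) : labeling lab ->
  portrays lab a s -> portrays lab b t ->
  (forall v, size v < n -> a v = b v) -> s = t.
Proof.
move=> hlab sa tb eab; apply/permP => v; apply/val_inj/(labeling_inj hlab).
by rewrite /= sa tb; apply: eq_act eab _; rewrite labeling_size // size_bseq.
Qed.

Lemma portrays_mul lab n a b (s t : {perm tree n}) :
  portrays lab a s -> portrays lab b t -> portrays lab (pmul a b) (s * t)%g.
Proof. by move=> sa tb v; rewrite permM tb sa act_pmul. Qed.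

Lemma portrays1 lab n : portrays lab (fun=> false) (1 : {perm tree n})%g.
Proof. by move=> v; rewrite perm1 act_false. Qed.

Lemma labeling_node lab n x : labeling lab -> size x <= n ->
  exists v : tree n, lab v = x.
Proof.
move=> hlab szx; have [ilab _ ilabK] := labeling_inv hlab.
have szi : size (ilab x) <= n by rewrite -(labeling_size _ hlab) ilabK.
by exists (Bseq szi); rewrite /= ilabK.
Qed.

Lemma M_portrait lab m n s : labeling lab ->
  s \in M lab m.+1 n <-> exists2 a, balanced m.+1 a & portrays lab a s.
Proof.
move=> hlab; rewrite inE; split=> [/asboolP[f /(Minf_portrait _ _ hlab)[a ba fa] fs]|].
  by exists a => // v; rewrite -(fs _ v (erefl _)) fa.
move=> [a ba sa]; have [ilab labK ilabK] := labeling_inv hlab; apply/asboolP.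
exists (fun v => ilab (act a (lab v))).
  by apply/Minf_portrait => //; exists a => // v; rewrite ilabK.
by move=> v u ->; rewrite -sa labK.
Qed.

Lemma group_set_M lab m n : labeling lab -> group_set (M lab m.+1 n).
Proof.
move=> hlab; apply/group_setP; split.
  by apply/M_portrait => //; exists (fun=> false); [exact: balanced0|exact: portrays1].
move=> s t /(M_portrait _ _ hlab)[a ba sa] /(M_portrait _ _ hlab)[b bb tb].
apply/M_portrait => //; exists (pmul a b); first exact: balanced_pmul.
exact: portrays_mul.
Qed.

(* Squaring kills one more level of the portrait. *)
Lemma portrays_exp2 lab n a (s : {perm tree n}) j : portrays lab a s ->
  exists2 b, portrays lab b (s ^+ (2 ^ j))%g & forall v, size v < j -> b v = false.
Proof.
move=> sa; elim: j => [|j [b sb b0]]; first by exists a.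
exists (pmul b b); first by rewrite expnS mulnC expgM expgS expg1; apply: portrays_mul.
by move=> v; rewrite ltnS => szv; rewrite /pmul (act_small b0) // addbb.
Qed.

Lemma pgroup_M lab m n (P : {group {perm tree n}}) : labeling lab ->
  P = M lab m.+1 n :> {set _} -> 2.-group%g P.
Proof.
move=> hlab PE; rewrite -pnat_exponent; apply: (@pnat_dvd _ (2 ^ n)); last first.
  by rewrite pnatX.
apply/exponentP => s; rewrite PE => /(M_portrait _ _ hlab)[a _ sa].
have [b sb b0] := portrays_exp2 n sa.
exact: portrays_eq hlab sb (@portrays1 lab n) b0.
Qed.

(** * The index-2 character and the odd-cousins parity *)

Lemma notin_index2_mul (gT : finGroupType) (G H : {group gT}) x y :
    H \subset G -> #|G : H|%g = 2 -> x \in G -> y \in G ->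
  ((x * y)%g \notin H) = (x \notin H) (+) (y \notin H).
Proof.
move=> sHG iH Gx Gy; case Hx: (x \in H); first by rewrite groupMl.
case Hy: (y \in H); first by rewrite groupMr // Hx.
have yGH : y \in G :\: H by rewrite inE Hy.
apply/negbTE; rewrite negbK; apply: contraFT Hx => Hxy.
by rewrite -(mulgK y x) -mem_rcoset (rcoset_index2 sHG iH yGH) inE Hxy groupM.
Qed.

Lemma odd_card_addb (T : finType) (A : {pred T}) :
  odd #|A| = \big[addb/false]_(x in A) true.
Proof. by rewrite -sum1_card (big_morph odd oddD (erefl _)). Qed.

(** Balance at [lab w] equates the sums over the two halves, so both children have the same sign and
    the true half decides. *)
Lemma acts_negatively_portrait lab m k a (s : {perm tree (m + k).+2})
    (w : tree (m + k).+2) :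
    labeling lab -> balanced k.+2 a -> portrays lab a s -> size w = m ->
  acts_negatively lab k.+2 s w <->
  \big[addb/false]_(t : k.-tuple bool) a (lab w ++ true :: t).
Proof.
move=> hlab ba sa szw.
pose S b := \big[addb/false]_(t : k.-tuple bool) a (lab w ++ b :: t).
have Seq b : S b = S true.
  have := ba (lab w); rewrite /= (big_addb_tupleS _ (fun t => a (lab w ++ t))).
  by rewrite -/(S true) -/(S false); case: b; case: (S true); case: (S false).
have sgnE (y : tree (m + k).+2) b : lab y = rcons (lab w) b ->
    sgn (fun v : tree (m + k).+2 => lab v) k.+1 s y = ((-1) ^+ (S true))%R.
  move=> ey; rewrite (sgn_act (a := a)) // => [|t].
    rewrite -(Seq b); congr (_ ^+ _)%R; congr nat_of_bool; apply: eq_bigr => t _.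
    by rewrite ey cat_rcons.
  apply: labeling_node => //.
  by rewrite ey size_cat size_rcons size_tuple labeling_size // szw; lia.
rewrite -/(S true) /acts_negatively /=; split=> [[y0 [y1 [wy0 _ _ + _]]]|St].
  move: wy0; rewrite -(child_labeling _ _ hlab) => /childP[b /sgnE->].
  by case: (S true).
have node b : exists y : tree (m + k).+2, lab y = rcons (lab w) b.
  by apply: labeling_node => //; rewrite size_rcons labeling_size // szw; lia.
have [[y0 e0] [y1 e1]] := (node false, node true); exists y0, y1.
rewrite (sgnE _ _ e0) (sgnE _ _ e1) St; split=> //.
- by rewrite -(child_labeling _ _ hlab) e0; apply/childP; eexists.
- by rewrite -(child_labeling _ _ hlab) e1; apply/childP; eexists.
- by apply/eqP => e; move: e0; rewrite e e1 => /rcons_inj[].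
Qed.

Lemma odd_cousins_portrait lab m k a (s : {perm tree (m + k).+2}) :
    labeling lab -> balanced k.+2 a -> portrays lab a s ->
  odd_cousins lab k.+2 (m + k).+2 s (tree_root (m + k).+2) <->
  \big[addb/false]_(y : m.-tuple bool) \big[addb/false]_(t : k.-tuple bool)
    a (y ++ true :: t).
Proof.
move=> hlab ba sa; have [ilab labK ilabK] := labeling_inv hlab.
rewrite /odd_cousins odd_card_addb.
have -> : (m + k).+2 - k.+2 = m by lia.
pose S x := \big[addb/false]_(t : k.-tuple bool) a (x ++ true :: t).
transitivity (\big[addb/false]_(w : tree (m + k).+2 | size w == m) S (lab w)).
  rewrite big_mkcond [in X in _ <-> X]big_mkcond /=.
  rewrite (eq_bigr (fun w : tree (m + k).+2 =>
    if size w == m then S (lab w) else false)) // => w _.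
  rewrite inE add0n prefix0s /=; case: eqP => //= szw.
  have := acts_negatively_portrait hlab ba sa szw; rewrite -/(S (lab w)).
  case: asboolP => An; case: (S _) => // -[] ? ?; exfalso; auto.
have szi (y : m.-tuple bool) : size (ilab y) <= (m + k).+2.
  by rewrite -(labeling_size _ hlab) ilabK size_tuple; lia.
pose h y : tree (m + k).+2 := Bseq (szi y).
(* Level [m] is indexed by words through the labeling; the default of [insubd] is never reached on
   nodes of that level. *)
rewrite (reindex h) /=; last first.
  exists (fun w : tree (m + k).+2 => insubd (nseq_tuple m false) (lab w)) => [y _|w].
    by apply: val_inj; rewrite /= val_insubd ilabK size_tuple eqxx.
  rewrite inE => szw; apply: val_inj.
  by rewrite /= val_insubd labeling_size // szw labK.
rewrite (eq_bigl xpredT) => [|y].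
  by rewrite (eq_bigr (fun y : m.-tuple bool => S y)) // => y _; rewrite ilabK.
by rewrite -(labeling_size _ hlab) ilabK size_tuple eqxx.
Qed.

Unset Implicit Arguments.

Theorem theorem5p4 (n l : nat) (hl : 2 <= l) (hn : l <= n)
    (lab : seq bool -> seq bool) (hlab : labeling lab)
    (G : {group {perm tree n}}) (hG : G \subset M lab l n)
    (hrestr : restr n.-1 G = M lab l n.-1)
    (hodd : exists s : {perm tree n},
        [/\ s \in G, acts_trivially n.-1 s & odd_cousins lab l n s (tree_root n)]) :
  G = M lab l n :> {set {perm tree n}}.
Proof.
have [k lE] : exists k, l = k.+2 by exists l.-2; lia.
have [m nE] : exists m, n = (m + k).+2 by exists (n - l); lia.
subst l n; rewrite /= in hrestr hodd.
pose P : {group {perm tree (m + k).+2}} := Group (group_set_M k.+1 (m + k).+2 hlab).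
(* Either [G] is everything or it lies in a maximal subgroup [H], of index 2 in a 2-group; the
   latter is refuted by showing that [P] lies in [H]. *)
have [->//|[H maxH sGH]] := @maximal_exists _ G P hG.
have pP : 2.-group%g P by apply: (@pgroup_M lab k.+1).
have iH := p_maximal_index pP maxH; have sHP := maxgroupp maxH.
have {sHP} /andP[sHP /negP nPH] : H \proper P by [].
case: nPH; pose of_p := perm_of_portrait (m + k).+2 hlab.
have of_pP a : portrays lab a (of_p a) by apply: perm_of_portraitP.
have of_p_eq a s : portrays lab a s -> of_p a = s.
  by move=> sa; apply: (portrays_eq hlab (of_pP a) sa).
have P_of a : balanced k.+2 a -> of_p a \in P.
  by move=> ba; apply/M_portrait => //; exists a.
pose chi a := of_p a \notin H.
have hchi : pchar (m + k).+2 k.+2 chi.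
  split=> [a b ba bb|a b eab].
    rewrite /chi -(notin_index2_mul sHP iH (P_of a ba) (P_of b bb)).
    by rewrite (of_p_eq _ _ (portrays_mul (of_pP a) (of_pP b))).
  by rewrite /chi (portrays_eq hlab (of_pP a) (of_pP b) eab).
have chiG a s : s \in G -> portrays lab a s -> chi a = false.
  by move=> Gs /of_p_eq; rewrite /chi => ->; rewrite (subsetP sGH).
(* The odd-cousins element of [G] has [chi] equal to the value on the base fork, and [chi] vanishes
   on [G]. *)
have ref0 : chi (fork_ref m k) = false.
  have [s [Gs s_triv s_odd]] := hodd.
  have /(M_portrait _ _ hlab)[a ba sa] := subsetP hG s Gs.
  have a0 v : size v < (m + k).+1 -> a v = false.
    apply: (@act_eq (m + k).+1 a (fun=> false)) => {}v szv.
    have [w ew] : exists w : tree (m + k).+2, lab w = v.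
      by apply: labeling_node => //; lia.
    by rewrite act_false -ew -sa s_triv // -(labeling_size _ hlab) ew.
  have := pchar_top hchi ba a0; rewrite (chiG a s) //.
  have /(odd_cousins_portrait hlab ba sa)-> := s_odd.
  by rewrite andbT.
apply/subsetP => s /(M_portrait _ _ hlab)[a ba sa].
(* Some [g] in [G] has the same restriction [t] as [s]; it remains to treat the quotient of [s] by
   [g]. *)
have [t ta] := portrays_ex (m + k).+1 a hlab.
have : t \in restr (m + k).+1 G by rewrite hrestr; apply/M_portrait => //; exists a.
rewrite inE => /existsP[g /andP[Gg /asboolP gt]].
have /(M_portrait _ _ hlab)[b bb gb] := subsetP hG g Gg.
have eab : forall v, size v < (m + k).+1 -> a v = b v.
  apply: act_eq => v szv; have [w ew] := labeling_node hlab szv.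
  have [x ex] : exists x : tree (m + k).+2, lab x = v.
    by apply: labeling_node => //; lia.
  rewrite -{1}ew -ta -(gt x) ?gb ?ex //.
  by apply: (labeling_inj hlab); rewrite ex ew.
(* Cutting the difference to the single level [(m + k).+1] keeps it balanced, since each sum
   condition involves only one level. *)
pose c v := (size v == (m + k).+1) && (a v (+) b v).
have c0 v : size v < (m + k).+1 -> c v = false.
  by move=> szv; rewrite /c ltn_eqF.
have bc : balanced k.+2 c.
  move=> p; rewrite /c /=.
  under eq_bigr do rewrite size_cat size_tuple.
  case: eqP => _ /=; last by rewrite big1.
  by rewrite big_split /= [X in X (+) _]ba [X in _ (+) X]bb.
have sE : s = (of_p c * g)%g.
  apply: (portrays_eq hlab sa (portrays_mul (of_pP c) gb)) => v.
  rewrite ltnS leq_eqVlt /pmul => /orP[szv|szv].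
    by rewrite (act_small c0) ?(eqP szv) // /c szv /= addbK.
  by rewrite c0 // (act_small c0) ?eab // ltnW.
rewrite sE groupMr; last exact: (subsetP sGH).
by have := pchar_top hchi bc c0; rewrite ref0 => /negbFE.
Qed.
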